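(* Let $\mathcal{Z}\subseteq\mathbb{R}^d$ be a nonempty convex set, let $L>0$, $\delta\ge 0$, and let $F,H:\mathcal{Z}\to\mathbb{R}^d$ be continuous operators such that $F$ is monotone, $F$ is $L$-relatively Lipschitz with respect to $H$, and $H$ is $\delta$ conservative. Let $K\ge1$, let $z_1\in\mathcal{Z}$, and let $z_{k+\frac12},z_{k+1}\in\mathcal{Z}$ ($k=1,\dots,K$) be iterates generated by the MFMP algorithm, with output $z_{\mathrm{out}}=\frac1K\sum_{k=1}^K z_{k+\frac12}$. Then for every $z\in\mathcal{Z}$, $$\langle F(z),z_{\mathrm{out}}-z\rangle\le\frac{L}{K}\,\omega_H(z,z_1)+2L\delta .$$
   Context: Operators are maps $\mathcal{Z}\to\mathbb{R}^d$, and $\langle\cdot,\cdot\rangle$ is the Euclidean inner product. Line integrals: for a curve $\mathcal{C}$ in $\mathcal{Z}$ parameterized by $r:[a,b]\to\mathcal{C}$ (piecewise smooth, one-to-one except that the endpoints coincide when $\mathcal{C}$ is closed), $\int_{\mathcal{C}}H(r)^\top dr=\int_a^b\langle H(r(t)),r'(t)\rangle\,dt$; it is written $\oint$ when $\mathcal{C}$ is closed. Along the straight segment from $z_a$ to $z_b$: $\int_{z_a}^{z_b}H(r)^\top dr=\int_0^1\langle H(z_a+t(z_b-z_a)),z_b-z_a\rangle\,dt$. Generalized Bregman divergence (GBD): $\omega_H(z_b,z_a)=\int_{z_a}^{z_b}H(r)^\top dr-\langle H(z_a),z_b-z_a\rangle$. $F$ is monotone if $\langle F(z_b)-F(z_a),z_b-z_a\rangle\ge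 0$ for all $z_a,z_b\in\mathcal{Z}$. $F$ is $L$-relatively Lipschitz with respect to $H$ if for all $z_a,z_b,z_c\in\mathcal{Z}$, $L(\omega_H(z_b,z_c)+\omega_H(z_a,z_b))\ge\langle F(z_c)-F(z_b),z_a-z_b\rangle$. $H$ is $\delta$ conservative if $-\delta\le\oint_{\mathcal{C}}H(r)^\top dr\le\delta$ for every closed curve $\mathcal{C}$ in $\mathcal{Z}$. MFMP algorithm (Mirror-Free Mirror Prox): define $\mathrm{Prox}_H(z_a,z_b)=\{z'\in\mathcal{Z}:\langle F(z_b)+L(H(z')-H(z_a)),z'-z\rangle\le 0\ \ \forall z\in\mathcal{Z}\}$. Starting from $z_1\in\mathcal{Z}$, for $k=1,\dots,K$ choose $z_{k+\frac12}\in\mathrm{Prox}_H(z_k,z_k)$ and $z_{k+1}\in\mathrm{Prox}_H(z_k,z_{k+\frac12})$ (such points are assumed to exist). Output $z_{\mathrm{out}}=\frac1K\sum_{k=1}^Kz_{k+\frac12}$. *)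

(* Defs.v *)
From mathcomp Require Export all_boot all_order all_algebra.
From mathcomp Require Export all_classical all_reals all_analysis.
Export Order.TTheory GRing.Theory Num.Theory.
Export numFieldNormedType.Exports.

Set Implicit Arguments.
Unset Strict Implicit.
Unset Printing Implicit Defensive.

Local Open Scope classical_set_scope.
Local Open Scope ring_scope.

(* An operator on Z is a total map on 'rV[R]_d; every definition below uses its
   values at points of Z only, and its continuity is stated within Z. *)

Definition dot (R : realType) (d : nat) (u v : 'rV[R]_d) : R :=
  \sum_(i < d) u 0 i * v 0 i.

(* \int_C H(r)^T dr; at the finitely many break points of a piecewise smooth r
   the value of derive1 r is immaterial. *)
Definition line_integral (R : realType) (d : nat)
    (H : 'rV[R]_d -> 'rV[R]_d) (r : R -> 'rV[R]_d) (a b : R) : R :=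
  \int[lebesgue_measure]_(t in `[a, b]) dot (H (r t)) (derive1 r t).

Definition segment_integral (R : realType) (d : nat)
    (H : 'rV[R]_d -> 'rV[R]_d) (za zb : 'rV[R]_d) : R :=
  \int[lebesgue_measure]_(t in `[0, 1])
    dot (H (za + t *: (zb - za))) (zb - za).

Definition gbd (R : realType) (d : nat)
    (H : 'rV[R]_d -> 'rV[R]_d) (zb za : 'rV[R]_d) : R :=
  segment_integral H za zb - dot (H za) (zb - za).

Definition monotone_op (R : realType) (d : nat) (Z : set 'rV[R]_d)
    (F : 'rV[R]_d -> 'rV[R]_d) : Prop :=
  forall za zb, Z za -> Z zb -> 0 <= dot (F zb - F za) (zb - za).

Definition relatively_lipschitz (R : realType) (d : nat) (Z : set 'rV[R]_d)
    (L : R) (F H : 'rV[R]_d -> 'rV[R]_d) : Prop :=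
  forall za zb zc, Z za -> Z zb -> Z zc ->
    dot (F zc - F zb) (za - zb) <= L * (gbd H zb zc + gbd H za zb).

(* Smoothness on the closed interval [a, b], with one-sided derivatives at the
   end points, expressed as agreement on [a, b] with a smooth map on R. *)
Definition smooth_on (R : realType) (d : nat) (r : R -> 'rV[R]_d) (a b : R) :
    Prop :=
  exists2 g : R -> 'rV[R]_d,
    (forall n t, derivable (derive1n n g) t 1) &
    (forall t, a <= t <= b -> r t = g t).

(* Consecutive closed pieces share an end point, so r is continuous on [a, b]. *)
Definition piecewise_smooth (R : realType) (d : nat) (r : R -> 'rV[R]_d)
    (a b : R) : Prop :=
  exists2 s : seq R, itv_partition a b s &
    forall i, (i < size s)%N -> smooth_on r (nth b (a :: s) i) (nth b s i).

(* r, restricted to [a, b], parameterizes a closed curve contained in Z. *)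
Definition closed_curve (R : realType) (d : nat) (Z : set 'rV[R]_d)
    (r : R -> 'rV[R]_d) (a b : R) : Prop :=
  [/\ a < b,
      (forall t, a <= t <= b -> Z (r t)),
      piecewise_smooth r a b,
      r a = r b &
      (forall t u, a <= t -> t < u -> u <= b -> r t = r u -> t = a /\ u = b)].

Definition conservative (R : realType) (d : nat) (Z : set 'rV[R]_d)
    (delta : R) (H : 'rV[R]_d -> 'rV[R]_d) : Prop :=
  forall (r : R -> 'rV[R]_d) (a b : R), closed_curve Z r a b ->
    - delta <= line_integral H r a b <= delta.

Definition Prox (R : realType) (d : nat) (Z : set 'rV[R]_d) (L : R)
    (F H : 'rV[R]_d -> 'rV[R]_d) (za zb : 'rV[R]_d) : set 'rV[R]_d :=
  [set z' | Z z' /\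
    forall z, Z z -> dot (F zb + L *: (H z' - H za)) (z' - z) <= 0].

(* zs k is z_k and zh k is z_(k + 1/2). *)
Definition MFMP (R : realType) (d : nat) (Z : set 'rV[R]_d) (L : R)
    (F H : 'rV[R]_d -> 'rV[R]_d) (K : nat) (zs zh : nat -> 'rV[R]_d) : Prop :=
  Z (zs 1%N) /\
  forall k, (1 <= k <= K)%N ->
    Prox Z L F H (zs k) (zs k) (zh k) /\
    Prox Z L F H (zs k) (zh k) (zs k.+1).

Definition MFMP_output (R : realType) (d : nat) (K : nat)
    (zh : nat -> 'rV[R]_d) : 'rV[R]_d :=
  K%:R^-1 *: \sum_(1 <= k < K.+1) zh k.

(* Main.v *)
Require Import Defs.
From mathcomp Require Import measurable_realfun.
From mathcomp Require Import ring lra.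

(** Write [I a b] for the integral of [H] along the segment from [a] to [b].
    Since [gbd H b a] is [I a b] minus the linear term at [a], the three-point
    identity of Bregman divergences survives without a potential, up to the
    integral of [H] around a triangle:
      gbd z zk - gbd z z' - gbd z' zk
        = <H z' - H zk, z - z'> + (I zk z + I z z' + I z' zk).
    The usual analysis of Mirror Prox then goes through: the two proximal
    inequalities, the first one tested at [z' = z_(k+1)], are added to relative
    Lipschitzness, and two instances of the identity, on the triangles
    [zk, z, z'] and [zk, z', zh], cancel every divergence except
    [gbd z zk - gbd z z'].  Each triangle costs at most [L * delta], which is the
    source of the error term [2 * L * delta] ([MFMP_step]).  Summing over [k]
    telescopes, the last divergence is nonnegative ([gbd_ge0], which is relative
    Lipschitzness at coinciding points), and monotonicity replaces [F zh] by
    [F z].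

    What remains is the bound on triangles ([circulation_bound]).  Closed curves
    are required to be simple, so there are two cases.  When no vertex lies on the
    opposite side, running through the three sides on [[0, 3]] gives a simple
    closed curve in [Z] ([closed_curve_triangle]) whose line integral is the sum
    of the three segment integrals ([line_integral_triangle]).  Otherwise a vertex
    cuts the opposite side into the two other ones, and the three integrals
    cancel exactly, because segment integrals are additive and change sign with
    the orientation ([circulation_flat]). *)

Set Implicit Arguments.
Unset Strict Implicit.
Unset Printing Implicit Defensive.

Local Open Scope classical_set_scope.
Local Open Scope ring_scope.

Local Notation mu := lebesgue_measure.

(** * Bilinearity and continuity of the inner product *)

Section Dot.
Context {R : realType} {d : nat}.
Implicit Types (u v w : 'rV[R]_d) (k : R).

Lemma dotC u v : dot u v = dot v u.
Proof. by apply: eq_bigr => i _; rewrite mulrC. Qed.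

Lemma dotDl u v w : dot (u + v) w = dot u w + dot v w.
Proof. by rewrite -big_split; apply: eq_bigr => i _; rewrite mxE mulrDl. Qed.

Lemma dotZl k u v : dot (k *: u) v = k * dot u v.
Proof. by rewrite mulr_sumr; apply: eq_bigr => i _; rewrite mxE mulrA. Qed.

Lemma dotBl u v w : dot (u - v) w = dot u w - dot v w.
Proof. by rewrite dotDl -scaleN1r dotZl mulN1r. Qed.

Lemma dotZr k u v : dot u (k *: v) = k * dot u v.
Proof. by rewrite dotC dotZl dotC. Qed.

Lemma dotBr u v w : dot u (v - w) = dot u v - dot u w.
Proof. by rewrite dotC dotBl !(dotC _ u). Qed.

Lemma dotNr u v : dot u (- v) = - dot u v.
Proof. by rewrite -scaleN1r dotZr mulN1r. Qed.

Lemma dotr0 u : dot u 0 = 0.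
Proof. by rewrite -(scale0r 0) dotZr mul0r. Qed.

Lemma dot_sumr (I : Type) (s : seq I) (P : pred I) u (v : I -> 'rV[R]_d) :
  dot u (\sum_(i <- s | P i) v i) = \sum_(i <- s | P i) dot u (v i).
Proof.
elim/big_rec2: _ => [|i x y _ <-]; first exact: dotr0.
by rewrite dotC dotDl !(dotC _ u).
Qed.

Lemma continuous_dot v : continuous (fun u => dot u v : R).
Proof.
apply: continuous_big => [|i _ u]; first exact: add_continuous.
apply: (@continuousM _ _ (fun u : 'rV[R]_d => u 0 i) (cst (v 0 i)) u).
  exact: coord_continuous.
exact: cst_continuous.
Qed.

End Dot.

(** * Integrals over intervals *)

Section Interval.
Context {R : realType}.
Implicit Types (f g : R -> R) (p q s : R).

Lemma integrable_continuous_itv f p q :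
  {within `[p, q], continuous f} -> mu.-integrable `[p, q] (EFin \o f).
Proof.
by move=> fc; apply: continuous_compact_integrable => //; exact: segment_compact.
Qed.

Lemma Rintegral_affine f p q : p < q -> {within `[p, q], continuous f} ->
  \int[mu]_(t in `[p, q]) f t =
  \int[mu]_(t in `[0, 1]) (f (p + t * (q - p)) * (q - p)).
Proof.
move=> pq fc; pose A t : R := p + t * (q - p).
have Ad (t : R) : is_derive t (1 : R) A (q - p).
  have -> : A = cst p + (q - p) \*: id by apply/funext => x; rewrite /A /= mulrC.
  by apply: is_derive_eq; rewrite add0r /GRing.scale /= mulr1.
have A' : derive1 A = cst (q - p).
  by apply/funext => t; rewrite derive1E derive_val.
have A0 : A 0 = p by rewrite /A mul0r addr0.
have A1 : A 1 = q by rewrite /A mul1r addrC subrK.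
have Ac : continuous A.
  by move=> t; apply: differentiable_continuous; apply/derivable1_diffP.
rewrite /Rintegral; congr fine.
have := @integration_by_substitution_increasing R A f 0 1 ler01.
rewrite A0 A1 A' => -> //.
- by move=> x y _ _ xy; rewrite ltrD2l ltr_pM2r// subr_gt0.
- by move=> x _; exact: cvg_cst.
- exact: is_cvg_cst.
- exact: is_cvg_cst.
- split => [t _||]; first exact: ex_derive.
  + exact/cvg_at_right_filter/Ac.
  + exact/cvg_at_left_filter/Ac.
Qed.

(** The integrand of a line integral is known only inside each piece, since at the
    ends of a piece the derivative of the curve is arbitrary; the two end points
    are a null set, so a continuous model of the integrand decides both
    integrability and the integral. *)
Lemma Rintegral_oo f g p q : {within `[p, q], continuous g} ->
  {in `]p, q[, f =1 g} ->
  mu.-integrable `[p, q] (EFin \o f) /\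
  \int[mu]_(t in `[p, q]) f t = \int[mu]_(t in `[p, q]) g t.
Proof.
move=> /integrable_continuous_itv ig fg.
have fgE : {in `]p, q[, EFin \o f =1 EFin \o g} by move=> t /fg /= ->.
have mg : measurable_fun `]p, q[ g.
  have /measurable_EFinP := measurable_int _ ig.
  by apply: measurable_funS => //; exact: subset_itvW.
have mf : measurable_fun `]p, q[ f.
  by apply: eq_measurable_fun mg => t; rewrite inE => /fg.
have oo (h : R -> R) : measurable_fun `]p, q[ h ->
    (\int[mu]_(t in `[p, q]) (h t)%:E = \int[mu]_(t in `]p, q[) (h t)%:E)%E.
  by move=> /measurable_EFinP mh; exact: integral_itv_bndoo.
split; last first.
  rewrite /Rintegral (oo f mf) (oo g mg); congr fine.
  by apply: eq_integral => t; rewrite inE => /fgE.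
apply/integrableP; split.
  apply/measurable_EFinP.
  exact/measurable_fun_itv_obnd_cbndP/measurable_fun_itv_bndo_bndcP.
have /integrableP[_] := ig.
have /= -> := oo (Num.norm \o g) (measurableT_comp (@normr_measurable R setT) mg).
have /= -> := oo (Num.norm \o f) (measurableT_comp (@normr_measurable R setT) mf).
apply: le_lt_trans; rewrite le_eqVlt; apply/orP; left; apply/eqP.
by apply: eq_integral => t; rewrite inE => /fg ->.
Qed.

(** Integrability on the union is part of the conclusion because the integrand of
    a piecewise smooth curve may jump at the break points, so that no
    continuity argument on the whole interval provides it. *)
Lemma Rintegral_cat f p s q : p <= s -> s <= q ->
  mu.-integrable `[p, s] (EFin \o f) ->
  mu.-integrable `[s, q] (EFin \o f) ->
  mu.-integrable `[p, q] (EFin \o f) /\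
  \int[mu]_(t in `[p, q]) f t =
    \int[mu]_(t in `[p, s]) f t + \int[mu]_(t in `[s, q]) f t.
Proof.
move=> ps sq ips isq.
have isq' : mu.-integrable `]s, q] (EFin \o f).
  apply: integrableS isq => // t /=.
  by rewrite !in_itv/= => /andP[/ltW -> ->].
have ipq : mu.-integrable `[p, q] (EFin \o f).
  rewrite (@itv_bndbnd_setU _ _ _ (BRight s)) ?bnd_simp//.
  have [[mps lps] [msq lsq]] := (integrableP _ _ _ ips, integrableP _ _ _ isq').
  have mf : measurable_fun (`[p, s] `|` `]s, q]) f.
    by apply/measurable_funU => //; split; exact/measurable_EFinP.
  apply/integrableP; split; first exact/measurable_EFinP.
  rewrite ge0_integral_setU//; first exact: lte_add_pinfty.
    exact/measurableT_comp/measurable_EFinP.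
  apply/disj_setPS => y [/=]; rewrite 2!in_itv/= => /andP[_ ys] /andP[].
  by rewrite ltNge ys.
split=> //.
have /(_ (BLeft p) (BRight q) s ipq) := @Rintegral_itvB R f.
rewrite !bnd_simp => /(_ ps sq) e.
by rewrite -(Rintegral_itv_obnd_cbnd isq') -e addrC subrK.
Qed.

End Interval.

(** * Segments *)

Definition seg {R : realType} {d : nat} (a b : 'rV[R]_d) (t : R) : 'rV[R]_d :=
  a + t *: (b - a).

Section Seg.
Context {R : realType} {d : nat}.
Implicit Types (a b c v : 'rV[R]_d) (p s t : R).

Lemma seg0 a b : seg a b 0 = a.
Proof. by rewrite /seg scale0r addr0. Qed.

Lemma seg1 a b : seg a b 1 = b.
Proof. by rewrite /seg scale1r addrC subrK. Qed.

Lemma seg_rev a b t : seg b a (1 - t) = seg a b t.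
Proof. by apply/rowP => i; rewrite !mxE; ring. Qed.

Lemma seg_in_convex (Z : set 'rV[R]_d) a b t : convex_set Z -> Z a -> Z b ->
  0 <= t <= 1 -> Z (seg a b t).
Proof.
move=> cZ aZ bZ /andP[t0 t1].
have /set_mem := cZ b a (Itv01 t0 t1) (mem_set bZ) (mem_set aZ).
congr (Z _); rewrite /conv/= /seg /unstable.onem.
by apply/rowP => i; rewrite !mxE; ring.
Qed.

(** The offset [p] is carried along because the sides of a triangle are run
    through one after the other, each on its own unit interval. *)
Lemma is_derive_seg a b p t :
  is_derive t (1 : R) (fun t => seg a b (t - p)) (b - a).
Proof.
have cv : h^-1 *: (seg a b (h *: 1 + t - p) - seg a b (t - p)) @[h --> 0^']
    --> b - a.
  apply: cvg_near_cst; near=> h.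
  have h0 : h != 0 by near: h; exact: nbhs_dnbhs_neq.
  rewrite /seg opprD addrACA subrr add0r -scalerBl scalerA.
  rewrite (_ : _ * _ = 1) ?scale1r// /GRing.scale/= mulr1.
  by field.
apply: DeriveDef; first exact: cvgP cv.
exact: cvg_lim cv.
Unshelve. all: by end_near. Qed.

Lemma continuous_seg a b p : continuous (fun t => seg a b (t - p)).
Proof.
move=> t; apply: differentiable_continuous; apply/derivable1_diffP.
by have [] := is_derive_seg a b p t.
Qed.

Lemma smooth_on_seg (r : R -> 'rV[R]_d) a b p q :
  (forall t, p <= t <= q -> r t = seg a b (t - p)) -> smooth_on r p q.
Proof.
move=> rE; exists (fun t => seg a b (t - p)) => // n t.
have d1 : derive1 (fun t => seg a b (t - p)) = cst (b - a).
  by apply/funext => x; rewrite derive1E; have [_ ->] := is_derive_seg a b p x.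
case: n => [|n]; first by have [] := is_derive_seg a b p t.
rewrite derive1Sn d1.
suff [c ->] : exists c, derive1n n (cst (b - a) : R -> 'rV[R]_d) = cst c.
  exact: derivable_cst.
elim: n => [|n [c IH]]; first by exists (b - a).
by exists 0; rewrite derive1nS IH; apply/funext => x; rewrite derive1_cst.
Qed.

(** Continuity of [H] within [Z] is enough along a curve that stays in [Z]: near a
    parameter of [[p, q]] only the parameters of [[p, q]] matter, and these are
    sent into [Z]. *)
Lemma continuous_dot_along (Z : set 'rV[R]_d) (H : 'rV[R]_d -> 'rV[R]_d)
    (r : R -> 'rV[R]_d) v (p q : R) :
  {within Z, continuous H} -> continuous r ->
  (forall t, p <= t <= q -> Z (r t)) ->
  {within `[p, q], continuous (fun t => dot (H (r t)) v)}.
Proof.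
move=> /subspace_continuousP Hc rc rZ; apply/subspace_continuousP => t /= tpq.
have Zt : Z (r t) by apply: rZ; rewrite in_itv in tpq.
apply: (@cvg_comp _ _ _ (H \o r) (fun u => dot u v) _ (nbhs (H (r t))));
  last exact: continuous_dot.
apply: (@cvg_comp _ _ _ r H _ (within Z (nbhs (r t)))); last exact: Hc.
move=> A wA; have rA : \forall u \near t, Z (r u) -> A (r u) := rc t _ wA.
suff : \forall u \near t, u \in `[p, q] -> A (r u) by [].
near=> u => /=; rewrite in_itv/= => /rZ Zu.
by move: Zu; near: u.
Unshelve. all: by end_near. Qed.

Section SegmentIntegral.
Variables (Z : set 'rV[R]_d) (H : 'rV[R]_d -> 'rV[R]_d).
Hypotheses (cZ : convex_set Z) (Hc : {within Z, continuous H}).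

Lemma continuous_dot_seg a b v p : Z a -> Z b ->
  {within `[p, p + 1], continuous (fun t => dot (H (seg a b (t - p))) v)}.
Proof.
move=> aZ bZ; apply: (@continuous_dot_along Z H (fun t => seg a b (t - p))) => //.
  exact: continuous_seg.
by move=> t tp; apply: seg_in_convex => //; lra.
Qed.

Lemma continuous_dot_seg01 a b v : Z a -> Z b ->
  {within `[0, 1], continuous (fun t => dot (H (seg a b t)) v)}.
Proof.
move=> aZ bZ; have := @continuous_dot_seg a b v 0 aZ bZ; rewrite add0r.
rewrite (_ : (fun t => dot (H (seg a b (t - 0))) v) =
  (fun t => dot (H (seg a b t)) v))//.
by apply/funext => t; rewrite subr0.
Qed.

Lemma segment_integral_id a : segment_integral H a a = 0.
Proof.
rewrite /segment_integral subrr.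
under eq_Rintegral do rewrite dotr0.
by rewrite Rintegral_cst// mul0r.
Qed.

Lemma segment_integral_rev a b : Z a -> Z b ->
  segment_integral H b a = - segment_integral H a b.
Proof.
move=> aZ bZ.
rewrite -[LHS]/(\int[mu]_(t in `[0, 1]) dot (H (seg b a t)) (a - b)).
rewrite (Rintegration_by_substitution_onem (r := 1)) ?ler01 ?lexx//; last first.
  exact: continuous_dot_seg01.
rewrite unstable.onem1 -mulN1r -RintegralZl//; last first.
  exact/integrable_continuous_itv/continuous_dot_seg01.
by apply: eq_Rintegral => t _; rewrite seg_rev mulN1r -dotNr opprB.
Qed.

(** Both parts are affine reparametrizations of the pieces [[0, s]] and [[s, 1]] of
    the integral along the whole segment; the factors [s] and [1 - s] of the change
    of variables are those of the direction vectors. *)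
Lemma segment_integral_split a c s : Z a -> Z c -> 0 <= s <= 1 ->
  segment_integral H a c =
  segment_integral H a (seg a c s) + segment_integral H (seg a c s) c.
Proof.
move=> aZ cZ' /andP[]; rewrite le_eqVlt => /predU1P[<- _|s0].
  by rewrite seg0 segment_integral_id add0r.
rewrite le_eqVlt => /predU1P[->|s1].
  by rewrite seg1 segment_integral_id addr0.
have fc := continuous_dot_seg01 (v := c - a) aZ cZ'.
have f0c : {within `[0, s], continuous (fun t => dot (H (seg a c t)) (c - a))}.
  apply: continuous_subspaceW fc => t /=; rewrite !in_itv/=; lra.
have fsc : {within `[s, 1], continuous (fun t => dot (H (seg a c t)) (c - a))}.
  apply: continuous_subspaceW fc => t /=; rewrite !in_itv/=; lra.
have [_] := Rintegral_cat (ltW s0) (ltW s1) (integrable_continuous_itv f0c)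
  (integrable_continuous_itv fsc).
rewrite -[LHS]/(segment_integral H a c) => ->.
rewrite (Rintegral_affine s0 f0c) (Rintegral_affine s1 fsc); congr (_ + _).
  apply: eq_Rintegral => t _; rewrite mulrC -dotZr; congr (dot (H _) _);
    by apply/rowP => i; rewrite !mxE; ring.
apply: eq_Rintegral => t _; rewrite mulrC -dotZr; congr (dot (H _) _);
  by apply/rowP => i; rewrite !mxE; ring.
Qed.

Lemma line_integral_piece (r : R -> 'rV[R]_d) a b p : Z a -> Z b ->
  (forall t, p < t < p + 1 -> r t = seg a b (t - p)) ->
  mu.-integrable `[p, p + 1] (EFin \o (fun t => dot (H (r t)) (derive1 r t))) /\
  line_integral H r p (p + 1) = segment_integral H a b.
Proof.
move=> aZ bZ rE.
have gc := continuous_dot_seg (v := b - a) (p := p) aZ bZ.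
have [|i e] := @Rintegral_oo R
    (fun t => dot (H (r t)) (derive1 r t)) _ _ _ gc.
  move=> t tp; have tp' : p < t < p + 1 by rewrite in_itv in tp.
  rewrite rE//; congr dot; rewrite derive1E.
  rewrite (@near_eq_derive _ _ _ _ (fun t => seg a b (t - p))).
  - by have [_ ->] := is_derive_seg a b p t.
  - near=> u; apply: rE.
    have : u \in `]p, p + 1[ by near: u; exact: near_in_itvoo.
    by rewrite in_itv.
split=> //; rewrite /line_integral e (Rintegral_affine _ gc) ?ltrDl//.
rewrite /segment_integral; apply: eq_Rintegral => t _.
by rewrite (addrC p 1) addrK !mulr1 (addrC p) addrK.
Unshelve. all: by end_near. Qed.

End SegmentIntegral.
End Seg.

(** * Triangles *)

Definition on_seg {R : realType} {d : nat} (x p q : 'rV[R]_d) : Prop :=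
  exists2 s, 0 <= s <= 1 & x = seg p q s.

Definition triangle {R : realType} {d : nat} (a b c : 'rV[R]_d) (t : R) :
    'rV[R]_d :=
  if t <= 1 then seg a b t
  else if t <= 2 then seg b c (t - 1) else seg c a (t - 2).

Section Triangle.
Context {R : realType} {d : nat}.
Implicit Types (a b c p q r : 'rV[R]_d) (s t u : R).

Lemma on_seg_sym x p q : on_seg x p q -> on_seg x q p.
Proof. by move=> [s s01 ->]; exists (1 - s); [lra|rewrite seg_rev]. Qed.

Lemma on_seg_left p q : on_seg p p q.
Proof. by exists 0; rewrite ?seg0// lexx ler01. Qed.

(** Two rays from a common vertex [p] meet elsewhere only when they have the same
    direction, and then the nearer one of [q], [r] lies between [p] and the
    other.  This is the whole geometry behind simplicity of triangles: any two
    sides share a vertex. *)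
Lemma rays_meet p q r s u : ~ on_seg q p r -> ~ on_seg r p q ->
  0 <= s -> 0 <= u -> s *: (q - p) = u *: (r - p) -> s = 0 /\ u = 0.
Proof.
wlog su : q r s u / s <= u.
  move=> wl nq nr s0 u0 e; have [su|/ltW us] := leP s u; first exact: (wl q r).
  by have [] := wl r q u s us nr nq u0 s0 (esym e).
move=> nq nr s0 u0 e.
have [u_eq0|u_neq0] := eqVneq u 0; first by split=> //; lra.
have u_gt0 : 0 < u by rewrite lt_def u_neq0.
case: nr; exists (s / u).
  by rewrite divr_ge0//= ler_pdivrMr// mul1r.
by rewrite /seg mulrC -scalerA e scalerA mulVf// scale1r addrC subrK.
Qed.

Lemma seg_inj p q : p != q -> injective (seg p q).
Proof.
move=> pq t u /addrI/eqP; rewrite -subr_eq0 -scalerBl scaler_eq0 !subr_eq0.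
by rewrite [q == p]eq_sym (negbTE pq) orbF => /eqP.
Qed.

Lemma triangle01 a b c t : t <= 1 -> triangle a b c t = seg a b t.
Proof. by rewrite /triangle => ->. Qed.

Lemma triangle12 a b c t : 1 <= t <= 2 -> triangle a b c t = seg b c (t - 1).
Proof.
rewrite /triangle => /andP[]; rewrite le_eqVlt => /predU1P[<- _|t1 ->].
  by rewrite lexx subrr seg0 seg1.
by rewrite leNgt t1.
Qed.

Lemma triangle23 a b c t : 2 <= t -> triangle a b c t = seg c a (t - 2).
Proof.
rewrite /triangle le_eqVlt => /predU1P[<-|t2].
  rewrite lexx subrr seg0 ifF; last by lra.
  by rewrite (_ : 2 - 1 = 1 :> R) ?seg1//; lra.
by rewrite !ifF//; lra.
Qed.

Lemma closed_curve_triangle (Z : set 'rV[R]_d) a b c : convex_set Z ->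
  Z a -> Z b -> Z c -> ~ on_seg a b c -> ~ on_seg b c a -> ~ on_seg c a b ->
  closed_curve Z (triangle a b c) 0 3.
Proof.
move=> cZ aZ bZ cZ' na nb nc.
have na' : ~ on_seg a c b by move/on_seg_sym.
have nb' : ~ on_seg b a c by move/on_seg_sym.
have nc' : ~ on_seg c b a by move/on_seg_sym.
have ab : a != b by apply/eqP => e; apply: na; rewrite e; exact: on_seg_left.
have bc : b != c by apply/eqP => e; apply: nb; rewrite e; exact: on_seg_left.
have ca : c != a by apply/eqP => e; apply: nc; rewrite e; exact: on_seg_left.
split.
- by rewrite ltr0n.
- move=> t t03; have [t1|t1] := leP t 1.
    by rewrite triangle01//; apply: seg_in_convex => //; lra.
  have [t2|t2] := leP t 2.
    by rewrite triangle12 ?(ltW t1)//; apply: seg_in_convex => //; lra.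
  by rewrite triangle23 ?(ltW t2)//; apply: seg_in_convex => //; lra.
- exists [:: 1; 2; 3 : R].
    by split => //=; rewrite andbT; apply/and3P; split; lra.
  case=> [|[|[|//]]] _ /=.
  + apply: (@smooth_on_seg _ _ _ a b) => t t01.
    by rewrite subr0 triangle01//; lra.
  + by apply: (@smooth_on_seg _ _ _ b c) => t t12; rewrite triangle12.
  + by apply: (@smooth_on_seg _ _ _ c a) => t t23; rewrite triangle23//; lra.
- rewrite triangle01 ?ler01// triangle23 ?ler_nat// seg0.
  by rewrite (_ : 3 - 2 = 1 :> R) ?seg1//; lra.
- move=> t u t0 tu u3.
  (* On one side, use injectivity of the segment; on two different sides, measure
     both points from the common vertex and apply rays_meet: the conclusion is
     contradictory, or says that both points are the base point. *)
  have [t1|t1] := leP t 1; have [u1|u1] := leP u 1.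
  + by rewrite !triangle01// => /(seg_inj ab) e; lra.
  + have [u2|u2] := leP u 2.
      rewrite triangle01// triangle12 ?(ltW u1)// => e.
      have [|||? ?] := @rays_meet b a c (1 - t) (u - 1) na nc'; [lra|lra| |lra].
      by apply/rowP => i; move/rowP/(_ i): e; rewrite !mxE; lra.
    rewrite triangle01// triangle23 ?(ltW u2)// => e.
    have [|||? ?] := @rays_meet a b c t (3 - u) nb' nc; [lra|lra| |lra].
    by apply/rowP => i; move/rowP/(_ i): e; rewrite !mxE; lra.
  + by lra.
  + have [t2|t2] := leP t 2; have [u2|u2] := leP u 2.
    * rewrite !triangle12 ?(ltW t1) ?(ltW u1)// => /(seg_inj bc) e; lra.
    * rewrite triangle12 ?(ltW t1)// triangle23 ?(ltW u2)// => e.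
      have [|||? ?] := @rays_meet c b a (2 - t) (u - 2) nb na'; [lra|lra| |lra].
      by apply/rowP => i; move/rowP/(_ i): e; rewrite !mxE; lra.
    * by lra.
    * rewrite !triangle23 ?(ltW t2) ?(ltW u2)// => /(seg_inj ca) e; lra.
Qed.

Section Circulation.
Variables (Z : set 'rV[R]_d) (H : 'rV[R]_d -> 'rV[R]_d).
Hypotheses (cZ : convex_set Z) (Hc : {within Z, continuous H}).

Definition circulation a b c :=
  segment_integral H a b + segment_integral H b c + segment_integral H c a.

(** Stated for the middle vertex; the other two positions follow by rotating the
    triangle, which permutes the three terms. *)
Lemma circulation_flat a b c : Z a -> Z c -> on_seg b a c ->
  circulation a b c = 0.
Proof.
move=> aZ cZ' [s s01 ->]; rewrite /circulation.
rewrite -(segment_integral_split cZ Hc)//.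
by rewrite (segment_integral_rev cZ Hc aZ cZ') subrr.
Qed.

Lemma line_integral_triangle a b c : Z a -> Z b -> Z c ->
  line_integral H (triangle a b c) 0 3 = circulation a b c.
Proof.
move=> aZ bZ cZ'.
have [|i1] := @line_integral_piece _ _ _ _ cZ Hc (triangle a b c) a b 0 aZ bZ.
  by move=> t t01; rewrite subr0 triangle01//; lra.
rewrite add0r in i1 *; move=> e1.
have [|i2] := @line_integral_piece _ _ _ _ cZ Hc (triangle a b c) b c 1 bZ cZ'.
  by move=> t t12; rewrite triangle12//; lra.
rewrite (_ : 1 + 1 = 2) in i2 *; last by lra.
move=> e2.
have [|i3] := @line_integral_piece _ _ _ _ cZ Hc (triangle a b c) c a 2 cZ' aZ.
  by move=> t t23; rewrite triangle23//; lra.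
rewrite (_ : 2 + 1 = 3) in i3 *; last by lra.
move=> e3.
have [||i12 e12] := Rintegral_cat _ _ i1 i2; [by lra..|].
have [||_ e123] := Rintegral_cat _ _ i12 i3; [by lra..|].
by rewrite /circulation -e1 -e2 -e3 /line_integral e123 e12.
Qed.

Lemma circulation_bound delta a b c : 0 <= delta -> conservative Z delta H ->
  Z a -> Z b -> Z c -> - delta <= circulation a b c <= delta.
Proof.
move=> d0 Hcons aZ bZ cZ'.
have flat : circulation a b c = 0 -> - delta <= circulation a b c <= delta.
  by move=> ->; lra.
have [abc|na] := pselect (on_seg a b c).
  apply: flat; rewrite -(circulation_flat cZ' bZ (on_seg_sym abc)) /circulation.
  by lra.
have [bca|nb] := pselect (on_seg b c a).
  by apply: flat; exact/(circulation_flat aZ cZ')/on_seg_sym.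
have [cab|nc] := pselect (on_seg c a b).
  apply: flat; rewrite -(circulation_flat bZ aZ (on_seg_sym cab)) /circulation.
  by lra.
rewrite -line_integral_triangle//.
exact/Hcons/closed_curve_triangle.
Qed.

End Circulation.
End Triangle.

(** * One step of mirror-free mirror prox *)

Section MirrorProx.
Context {R : realType} {d : nat}.
Variables (Z : set 'rV[R]_d) (L delta : R) (F H : 'rV[R]_d -> 'rV[R]_d).
Hypotheses (cZ : convex_set Z) (L_gt0 : 0 < L) (delta_ge0 : 0 <= delta).
Hypotheses (Hc : {within Z, continuous H}) (Hcons : conservative Z delta H).
Hypothesis F_lip : relatively_lipschitz Z L F H.

(** Nonnegativity, which for a Bregman divergence is convexity of the potential,
    comes here from relative Lipschitzness at [zc = zb], where the [F] term and one
    of the two divergences vanish. *)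
Lemma gbd_ge0 a b : Z a -> Z b -> 0 <= gbd H b a.
Proof.
move=> aZ bZ; have := F_lip bZ aZ aZ.
rewrite subrr dotC dotr0 {1}/gbd subrr dotr0 subr0 segment_integral_id add0r.
by rewrite pmulr_rge0.
Qed.

(** The two triangles are [zk, z, zk'], from the second proximal step, and
    [zk, zk', zh], from the first proximal step tested at [zk']; once their sides
    are oriented consistently, the claim is a linear combination of the
    hypotheses. *)
Lemma MFMP_step zk zh zk' z : Z zk -> Z z ->
  Prox Z L F H zk zk zh -> Prox Z L F H zk zh zk' ->
  dot (F zh) (zh - z) <= L * (gbd H z zk - gbd H z zk') + 2 * L * delta.
Proof.
move=> zkZ zZ [zhZ /(_ zk') P1] [zk'Z /(_ z zZ) P2].
have {P1} := P1 zk'Z; move: P2 (F_lip zk'Z zhZ zkZ).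
have /andP[T1 _] := circulation_bound cZ Hc delta_ge0 Hcons zkZ zZ zk'Z.
have /andP[T2 _] := circulation_bound cZ Hc delta_ge0 Hcons zkZ zk'Z zhZ.
have {T1} : L * - delta <= L * circulation H zk z zk' by rewrite ler_pM2l.
have {T2} : L * - delta <= L * circulation H zk zk' zh by rewrite ler_pM2l.
rewrite /circulation /gbd (segment_integral_rev cZ Hc zkZ zk'Z).
rewrite (segment_integral_rev cZ Hc zk'Z zZ) (segment_integral_rev cZ Hc zhZ zk'Z).
rewrite (segment_integral_rev cZ Hc zkZ zhZ).
rewrite !(dotBl, dotDl, dotZl, dotBr) => *; lra.
Qed.

End MirrorProx.

(** * Convergence of the averaged iterates *)

Theorem theorem3p3 (R : realType) (d : nat) (Z : set 'rV[R]_d)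
  (Z_neq0 : Z !=set0) (Z_convex : convex_set Z)
  (L delta : R) (L_gt0 : 0 < L) (delta_ge0 : 0 <= delta)
  (F H : 'rV[R]_d -> 'rV[R]_d)
  (F_cont : {within Z, continuous F}) (H_cont : {within Z, continuous H})
  (F_mono : monotone_op Z F)
  (F_lip : relatively_lipschitz Z L F H)
  (H_cons : conservative Z delta H)
  (K : nat) (K_ge1 : (1 <= K)%N)
  (zs zh : nat -> 'rV[R]_d) (iterates : MFMP Z L F H K zs zh)
  (z : 'rV[R]_d) (zZ : Z z) :
  dot (F z) (MFMP_output K zh - z) <=
    L / K%:R * gbd H z (zs 1%N) + 2 * L * delta.
Proof.
have [zs1Z step] := iterates.
have zsZ k : (k <= K)%N -> Z (zs k.+1).
  by case: k => [//|k kK]; have [//|_ []] := step k.+1.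
have K_gt0 : 0 < K%:R :> R by rewrite ltr0n.
have sum_bound : \sum_(1 <= k < K.+1) dot (F z) (zh k - z) <=
    L * (gbd H z (zs 1%N) - gbd H z (zs K.+1)) + K%:R * (2 * L * delta).
  apply: (@le_trans _ _ (\sum_(1 <= k < K.+1)
      (L * - (gbd H z (zs k.+1) - gbd H z (zs k)) + 2 * L * delta))).
    rewrite big_nat [leRHS]big_nat; apply: ler_sum => -[//|k] /andP[_ kK].
    have [P1 P2] := step k.+1 kK; have zhZ := P1.1.
    have := MFMP_step Z_convex L_gt0 delta_ge0 H_cont H_cons F_lip
      (zsZ k (ltnW kK)) zZ P1 P2.
    have := F_mono z (zh k.+1) zZ zhZ.
    by rewrite !dotBl => *; lra.
  rewrite big_split/= -mulr_sumr sumrN telescope_sumr// sumr_const_nat.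
  by rewrite subn1/= opprB (mulr_natl _ K).
have e : dot (F z) (MFMP_output K zh - z) =
    K%:R^-1 * \sum_(1 <= k < K.+1) dot (F z) (zh k - z).
  rewrite -dot_sumr sumrB sumr_const_nat subn1/= -dotZr scalerBr.
  by rewrite -(scaler_nat K z) scalerA mulVf ?scale1r// gt_eqF.
(* The telescoped sum ends with this divergence, which is dropped. *)
have w_ge0 := gbd_ge0 L_gt0 F_lip (zsZ K (leqnn K)) zZ.
rewrite e ler_pdivrMl// (le_trans sum_bound)//.
rewrite [leRHS]mulrDr lerD2r [L / _]mulrC mulrA mulrA mulfV ?gt_eqF// mul1r.
by rewrite ler_pM2l// gerBl.
Qed.
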